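(* For any integers $d, n, k_1, k_2, \ldots, k_{d-1}$ such that $d\geq 3$, $n \geq 10$, $k_1, k_2, \ldots, k_{d-1}\geq 2$ and $k_1+k_2+\cdots +k_{d-1}\leq n-1$, there exists a string C-group $(G, \{\rho_0, \rho_1, \ldots, \rho_{d-1}\})$ of order $2^n$ and type $\{2^{k_1}, 2^{k_2}, \ldots, 2^{k_{d-1}}\}$.
   Context: Let $G$ be a group and let $S=\{\rho_0,\ldots,\rho_{d-1}\}$ be a generating set of $G$ consisting of involutions (elements of order exactly $2$), indexed by $0,\ldots,d-1$. For $I\subseteq\{0,\ldots,d-1\}$, let $G_I$ denote the subgroup of $G$ generated by $\{\rho_i : i\in I\}$ (so $G_\emptyset$ is trivial). The pair $(G,S)$ is called a string C-group of rank $d$ if both of the following hold: (1) (string property) for any $i,j\in\{0,\ldots,d-1\}$ with $|i-j|>1$, $\rho_i$ and $\rho_j$ commute; (2) (intersection property) for any $I,J\subseteq\{0,\ldots,d-1\}$, $G_I\cap G_J=G_{I\cap J}$. The order of $(G,S)$ is the order of the group $G$. The type of $(G,S)$ is the ordered sequence, written $\{m_1,\ldots,m_{d-1}\}$, where $m_i$ is the (exact) order of the element $\rho_{i-1}\rho_i$ in $G$ for $1\leq i\leq d-1$. *)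

(* Defs.v *)
From HB Require Import structures.
From mathcomp Require Import all_boot all_order all_algebra all_fingroup.

Set Implicit Arguments.
Unset Strict Implicit.
Unset Printing Implicit Defensive.

Local Open Scope group_scope.

Section StringCGroup.

Variables (gT : finGroupType) (d : nat).

                                                                              
                                                          
Implicit Type rho : d.-tuple gT.

Definition parabolic rho (I : {set 'I_d}) : {group gT} :=
  <<[set tnth rho i | i in I]>>%G.

Definition string_property rho : Prop :=
  forall i j : 'I_d, (1 < `|(i : int) - (j : int)|)%N ->
    commute (tnth rho i) (tnth rho j).

Definition intersection_property rho : Prop :=
  forall I J : {set 'I_d},
    parabolic rho I :&: parabolic rho J = parabolic rho (I :&: J).

                                                                             
                                                 
Definition string_C_group (G : {group gT}) rho : Prop :=
  [/\ <<[set tnth rho i | i : 'I_d]>> = G,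
      forall i : 'I_d, #[tnth rho i] = 2,
      string_property rho
    & intersection_property rho].

                                                                             
                                              
Definition string_type rho : seq nat :=
  [seq #[nth 1 rho i.-1 * nth 1 rho i] | i <- iota 1 d.-1].

End StringCGroup.

(* Main.v *)
(** Amalgamating a string C-group [G] of rank d with a dihedral group along the
    last generator of [G] (taking the fibre product over the quotient of order 2
    that detects this generator) yields a string C-group of rank d + 1, the order
    of which is multiplied by that of the new rotation.  From the group of order 2
    this gives all types with order 2^(1 + k_1 + ... + k_(d-1)).

    Larger orders are created in rank 3.  Let L be the rank 3 group just built and
    let T be the symmetry group of a large toroidal map of type {4,4}, that is, a
    dihedral group wreathed with a group of order 2.  The diagonal subgroup H of
    T x L has the type of L and maps onto L.  In the 2-group H, a normal subgroup
    inside the kernel of H -> L can be found with any prescribed order dividing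
    that of the kernel; the quotient still lies above L and has the same type.
    This forces the map to L to be injective on the proper parabolic subgroups,
    so the quotient inherits the intersection property.  *)

Require Import Defs.
From mathcomp Require Import all_boot all_order all_algebra all_fingroup.
From HB Require Import structures.
From mathcomp Require Import all_solvable zify.

Set Implicit Arguments.
Unset Strict Implicit.
Unset Printing Implicit Defensive.

(** * Groups generated by two involutions *)

Section Pairs.

Local Open Scope group_scope.
Variables gT hT : finGroupType.

Lemma expg_pair (x : gT) (y : hT) n : (x, y) ^+ n = (x ^+ n, y ^+ n).
Proof. by elim: n => // n IHn; rewrite !expgS IHn. Qed.

Lemma order_pair (x : gT) (y : hT) : #[(x, y)] = lcmn #[x] #[y].
Proof.
apply/eqP; rewrite eqn_dvd order_dvdn expg_pair xpair_eqE -!order_dvdn.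
rewrite dvdn_lcml dvdn_lcmr dvdn_lcm !order_dvdn.
by have /eqP := expg_order (x, y); rewrite expg_pair xpair_eqE.
Qed.

End Pairs.

Section Involutions.

Local Open Scope group_scope.
Variable gT : finGroupType.
Implicit Types x y : gT.

Lemma order2P x : reflect (x != 1 /\ x * x = 1) (#[x] == 2).
Proof.
apply: (iffP eqP) => [ox | [xn1 xx]]; last exact: nt_prime_order.
by rewrite -order_gt1 ox; split=> //; rewrite -[RHS](expg_order x) ox.
Qed.

Lemma mem_cycle2 x y : x * x = 1 -> y \in <[x]> -> y = 1 \/ y = x.
Proof.
have [-> _ | xn1 xx] := eqVneq x 1; first by rewrite cycle1 => /set1P ->; left.
have ox : #[x] = 2 by apply/eqP/order2P.
by rewrite cycle2g // !inE => /orP[] /eqP; [left | right].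
Qed.

(** Since [x] inverts [x * y], the group is [<[x]> * <[x * y]>]. If the factors met, [x] and [y]
    would both lie in [<[x * y]>]; a cyclic group has one subgroup of order 2, so [x = y]. *)
Lemma card_gen_involutions x y :
  #[x] = 2 -> #[y] = 2 -> x != y -> #|<<[set x; y]>>| = (2 * #[x * y])%N.
Proof.
move=> ox oy neq_xy; have /eqP/order2P[_ xx] := ox; have /eqP/order2P[_ yy] := oy.
have xV : x^-1 = x by apply/eqP; rewrite eq_invg_mul xx.
have yV : y^-1 = y by apply/eqP; rewrite eq_invg_mul yy.
have nxC : <[x]> \subset 'N(<[x * y]>).
  rewrite cycle_subG; apply/normP; rewrite -cycleJ conjgE xV mulgA mulgA xx mul1g.
  by rewrite -cycleV invMg yV xV.
have yE : y = x * (x * y) by rewrite mulgA xx mul1g.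
have -> : <<[set x; y]>> = <[x]> * <[x * y]>.
  rewrite -norm_joinEl //; pose C := (<[x]> <*> <[x * y]>)%G; pose D := <<[set x; y]>>%G.
  have xC : x \in C by rewrite mem_gen // inE cycle_id.
  have xyC : x * y \in C by rewrite mem_gen // inE cycle_id orbT.
  have [xD yD] : x \in D /\ y \in D by rewrite !mem_gen ?set21 ?set22.
  rewrite -[LHS]/(gval D) -[RHS]/(gval C); apply/eqP.
  rewrite eqEsubset !join_subG !cycle_subG !sub1set xC xD groupM //= andbT.
  by have := groupM xC xyC; rewrite -yE.
rewrite TI_cardMg -?orderE ?ox //; apply: prime_TIg; first by rewrite -orderE ox.
apply: contra neq_xy; rewrite cycle_subG => xC.
have yC : y \in <[x * y]> by have := groupM xC (cycle_id _); rewrite -yE.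
have : <[x]> == <[y]>.
  have sub z : z \in <[x * y]> -> <[z]> \subset <[x * y]> by rewrite cycle_subG.
  by rewrite (eq_subG_cyclic (cycle_cyclic (x * y)) (sub x xC) (sub y yC)) -!orderE ox oy.
move=> /eqP eqC; have : y \in <[x]> by rewrite eqC cycle_id.
have /eqP/order2P[yn1 _] := oy.
by case/(mem_cycle2 xx) => [y1 | ->] //; rewrite y1 eqxx in yn1.
Qed.

End Involutions.

(** * The wreath product with a group of order 2 *)

Definition wreath2 (gT : Type) : Type := (gT * gT * bool)%type.
HB.instance Definition _ (gT : finType) := Finite.on (wreath2 gT).

Section Wreath.

Local Open Scope group_scope.
Variable gT : finGroupType.
Implicit Types u v : wreath2 gT.

(** The triple [(x, y, c)] stands for [base2 x y] followed by the swap when [c] holds. The type name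
    [wreath2] keeps this law apart from the componentwise law on products. *)
Definition wreath2_mul u v : wreath2 gT :=
  let: (x, y, c) := u in let: (x', y', c') := v in
  if c then (x * y', y * x', ~~ c') else (x * x', y * y', c').

Definition wreath2_inv u : wreath2 gT :=
  let: (x, y, c) := u in if c then (y^-1, x^-1, c) else (x^-1, y^-1, c).

Lemma wreath2_mulA : associative wreath2_mul.
Proof. by move=> [[x y] []] [[x' y'] []] [[x'' y''] []] /=; rewrite ?negbK !mulgA. Qed.

Lemma wreath2_mul1 : left_id (1, 1, false) wreath2_mul.
Proof. by move=> [[x y] c] /=; rewrite !mul1g. Qed.

Lemma wreath2_mulV : left_inverse (1, 1, false) wreath2_inv wreath2_mul.
Proof. by move=> [[x y] []] /=; rewrite !mulVg. Qed.

HB.instance Definition _ :=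
  Finite_isGroup.Build (wreath2 gT) wreath2_mulA wreath2_mul1 wreath2_mulV.

Definition base2 (x y : gT) : wreath2 gT := (x, y, false).
Definition swap2 : wreath2 gT := (1, 1, true).

Lemma base2M x y x' y' : base2 x y * base2 x' y' = base2 (x * x') (y * y').
Proof. by []. Qed.

Lemma base2X x y n : base2 x y ^+ n = base2 (x ^+ n) (y ^+ n).
Proof. by elim: n => // n IHn; rewrite !expgS IHn. Qed.

Lemma swap2_base2 x y : swap2 * base2 x y * swap2 = base2 y x.
Proof. by rewrite /mulg /= /wreath2_mul /= !mulg1 !mul1g. Qed.

Lemma swap2K : swap2 * swap2 = 1.
Proof. by rewrite /mulg /= /wreath2_mul /= !mulg1. Qed.

Lemma wreath2_parity u v : (u * v).2 = u.2 (+) v.2.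
Proof. by case: u v => [[x y] []] [[x' y'] []]. Qed.

Lemma card_wreath2 : 2.-nat #|gT| -> 2.-nat #|{: wreath2 gT}|.
Proof. by move=> pG; rewrite !card_prod card_bool !pnatM pG. Qed.

End Wreath.

(** * Dihedral 2-groups with their two parities *)

Definition C2 : Type := bool.
HB.instance Definition _ := Finite.on C2.
HB.instance Definition _ := Finite_isGroup.Build C2 addbA addFb addbb.

Section DihedralPair.

Local Open Scope group_scope.

Definition parity_hom (gT : finGroupType) (G : {set gT}) (e : gT -> bool) :=
  {in G &, {morph e : x y / x * y >-> x (+) y}}.

(** [da] and [db] are the parities of the number of occurrences of [a] and [b]. *)
Record dihedral_pair (k : nat) (gT : finGroupType) (a b : gT)
    (da db : gT -> bool) : Prop := DihedralPair {
  dp_2group : 2.-nat #|gT|;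
  dp_a2 : a * a = 1;
  dp_b2 : b * b = 1;
  dp_order : #[a * b] = (2 ^ k)%N;
  dp_da : parity_hom setT da;
  dp_db : parity_hom setT db;
  dp_daa : da a;
  dp_dab : ~~ da b;
  dp_dba : ~~ db a;
  dp_dbb : db b }.

Lemma parity_hom1 (gT : finGroupType) (G : {group gT}) e : parity_hom G e -> e 1 = false.
Proof. by move=> eM; have := eM 1 1 (group1 G) (group1 G); rewrite mulg1 addbb. Qed.

Lemma order_C2 : #[true : C2] = 2.
Proof. by apply/eqP/order2P. Qed.

Lemma dihedral_pair_base :
  dihedral_pair 1 ((true, false) : C2 * C2) ((false, true) : C2 * C2)
    (fun x => x.1) (fun x => x.2).
Proof.
split=> //; first by rewrite card_prod card_bool.
by rewrite order_pair order_C2.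
Qed.

(** The square of [swap2 * (a, b)] is [(b * a, a * b)], so the order doubles. *)
Lemma dihedral_pair_step k (gT : finGroupType) (a b : gT) da db :
  0 < k -> dihedral_pair k a b da db ->
  dihedral_pair k.+1 (swap2 gT) (base2 a b) (fun u => u.2)
    (fun u => da u.1.1 (+) da u.1.2).
Proof.
move=> k_gt0 [pG aa bb oab daM dbM daa dab dba dbb].
split; rewrite ?daa ?(negPf dab) ?(parity_hom1 daM) //=.
- exact: card_wreath2.
- exact: swap2K.
- by rewrite base2M aa bb.
- have sq : (swap2 gT * base2 a b) ^+ 2 = base2 (b * a) (a * b).
    by rewrite expgS expg1 mulgA swap2_base2 base2M.
  have ob2 : #[base2 (b * a) (a * b)] = (2 ^ k)%N.
    have oba : #[b * a] = #[a * b] by rewrite -(orderJ (a * b) a) conjgE -!mulgA mulKg.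
    apply/eqP; rewrite eqn_dvd -oab !order_dvdn base2X expg_order -{1}oba expg_order.
    by rewrite eqxx; have := expg_order (base2 (b * a) (a * b)); rewrite base2X => -[_ ->] /=.
  rewrite expnS -[2 in RHS]expn1; apply: orderXpfactor => //.
    by rewrite expn1 sq.
  by rewrite -(prednK k_gt0) expnS dvdn_mulr.
- by move=> u v _ _; apply: wreath2_parity.
(* The sum of [da] over both coordinates is invariant under the swap, hence a character; it is odd
   on [base2 a b] because [da] is odd on [a] and even on [b]. *)
- move=> [[x y] c] [[x' y'] c'] _ _.
  by case: c => /=; rewrite !daM ?inE //; case: (da x) (da y) (da x') (da y') => [] [] [] [].
Qed.

Lemma exists_dihedral_pair k : 0 < k ->
  exists (gT : finGroupType) (a b : gT) da db, dihedral_pair k a b da db.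
Proof.
case: k => // k _; elim: k => [|k [gT [a [b [da [db dp]]]]]].
  by exists (C2 * C2)%type; do 4 eexists; apply: dihedral_pair_base.
by exists (wreath2 gT); do 4 eexists; apply: dihedral_pair_step dp.
Qed.

Section Theory.

Variables (k : nat) (gT : finGroupType) (a b : gT) (da db : gT -> bool).
Hypothesis dp : dihedral_pair k a b da db.

Lemma dp_a_neq1 : a != 1.
Proof. by apply: contraL (dp_daa dp) => /eqP->; rewrite (parity_hom1 (dp_da dp)). Qed.

Lemma dp_b_neq1 : b != 1.
Proof. by apply: contraL (dp_dbb dp) => /eqP->; rewrite (parity_hom1 (dp_db dp)). Qed.

Lemma dp_neq : a != b.
Proof. by apply: contraL (dp_daa dp) => /eqP->; apply: dp_dab dp. Qed.

Lemma dp_oa : #[a] = 2.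
Proof. by apply/eqP/order2P; rewrite dp_a_neq1 (dp_a2 dp). Qed.

Lemma dp_ob : #[b] = 2.
Proof. by apply/eqP/order2P; rewrite dp_b_neq1 (dp_b2 dp). Qed.

Lemma dp_ker_notin x : x \in <<[set b; b ^ a]>> -> ~~ da x.
Proof.
have aV : a^-1 = a by apply/eqP; rewrite eq_invg_mul (dp_a2 dp).
have daMg : group_set [set y | ~~ da y].
  apply/group_setP; split=> [|z t]; rewrite !inE ?(parity_hom1 (dp_da dp)) //.
  by rewrite (dp_da dp) ?inE // => /negPf-> /negPf->.
move=> xM; have: x \in Group daMg.
  apply: subsetP xM; rewrite gen_subG; apply/subsetP=> z.
  rewrite !inE => /orP[] /eqP->; first exact: dp_dab dp.
  by rewrite conjgE !(dp_da dp) ?inE // aV (negPf (dp_dab dp)) addbb.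
by rewrite !inE.
Qed.

(** As [a] normalizes [<<[set b; b ^ a]>>], each element is [y] or [y * a] with [y] in this
    subgroup, and [da] is odd on [y * a]. Hence the subgroup is the kernel of [da] on
    [<<[set a; b]>>]. *)
Lemma dp_ker x : x \in <<[set a; b]>> -> ~~ da x -> x \in <<[set b; b ^ a]>>.
Proof.
have aV : a^-1 = a by apply/eqP; rewrite eq_invg_mul (dp_a2 dp).
have nMa : <[a]> \subset 'N(<<[set b; b ^ a]>>).
  rewrite cycle_subG; apply/normP; rewrite -genJ; congr <<_>>.
  by rewrite conjUg !conjg_set1 -conjgM (dp_a2 dp) conjg1 setUC.
have sub : <<[set a; b]>> \subset <<[set b; b ^ a]>> * <[a]>.
  rewrite -norm_joinEr // join_subG !sub1set.
  rewrite mem_gen; last by rewrite inE cycle_id orbT.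
  by rewrite mem_gen // inE mem_gen // set21.
move=> /(subsetP sub) /mulsgP[y z yM za ->].
case: (mem_cycle2 (dp_a2 dp) za) => ->; first by rewrite mulg1.
by rewrite (dp_da dp) ?inE // (dp_daa dp) (negPf (dp_ker_notin yM)).
Qed.

(** [b] and [b ^ a] are involutions with product [(b * a) ^+ 2]. *)
Lemma dp_card_ker : 1 < k -> #|<<[set b; b ^ a]>>| = (2 ^ k)%N.
Proof.
move=> k_gt1; have aV : a^-1 = a by apply/eqP; rewrite eq_invg_mul (dp_a2 dp).
have k2E : (2 ^ k = 2 * 2 ^ k.-1)%N by rewrite -expnS (ltn_predK k_gt1).
have oba : #[b * b ^ a] = (2 ^ k.-1)%N.
  have -> : b * b ^ a = (b * a) ^+ 2 by rewrite conjgE aV expgS expg1 !mulgA.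
  have -> : b * a = (a * b) ^ a by rewrite conjgE -!mulgA mulKg.
  by rewrite -conjXg orderJ orderXdiv (dp_order dp) k2E ?mulKn ?dvdn_mulr.
(* Equality would make [b * b ^ a] trivial, whereas its order [2 ^ k.-1] exceeds 1. *)
have neq : b != b ^ a.
  apply/eqP=> eqb; move: oba; rewrite -eqb (dp_b2 dp) order1.
  by case: k k_gt1 => [|[|n]] // _; rewrite expnS; lia.
by rewrite card_gen_involutions ?orderJ ?dp_ob // oba k2E.
Qed.

End Theory.

End DihedralPair.

(** * Amalgamation with a dihedral group *)

Section StringGroups.

Local Open Scope group_scope.

(** Generators are indexed by [nat], with only [r 0], ..., [r e] being relevant;
    the rank is [e.+1]. *)
Definition par (gT : finGroupType) (e : nat) (r : nat -> gT) (P : pred nat) : {set gT} :=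
  <<[set r (val i) | i : 'I_e.+1 & P (val i)]>>.

Canonical par_group (gT : finGroupType) e (r : nat -> gT) P :=
  Eval hnf in [group of par e r P].

Lemma mem_par (gT : finGroupType) e (r : nat -> gT) (P : pred nat) i :
  i <= e -> P i -> r i \in par e r P.
Proof.
move=> le_ie Pi; apply/mem_gen/imsetP.
by exists (Ordinal (le_ie : i < e.+1)); rewrite ?inE.
Qed.

Lemma par_subP (gT : finGroupType) e (r : nat -> gT) (P : pred nat) (K : {group gT}) :
  (forall i, i <= e -> P i -> r i \in K) -> par e r P \subset K.
Proof.
move=> rK; rewrite gen_subG; apply/subsetP=> x /imsetP[i]; rewrite inE => Pi ->.
by apply: rK; rewrite // -ltnS ltn_ord.
Qed.

Lemma parS (gT : finGroupType) e (r : nat -> gT) (P Q : pred nat) :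
  (forall i, i <= e -> P i -> Q i) -> par e r P \subset par e r Q.
Proof. by move=> sPQ; apply: par_subP => i le_ie /(sPQ i le_ie); apply: mem_par. Qed.

Lemma eq_par (gT : finGroupType) e (r s : nat -> gT) (P : pred nat) :
  (forall i, i <= e -> r i = s i) -> par e r P = par e s P.
Proof.
move=> eqrs; apply/eqP; rewrite eqEsubset; apply/andP; split.
  by apply: par_subP => i le_ie Pi; rewrite eqrs // mem_par.
by apply: par_subP => i le_ie Pi; rewrite -eqrs // mem_par.
Qed.

Lemma morphim_par (gT hT : finGroupType) (D : {group gT}) (f : {morphism D >-> hT})
    e (r : nat -> gT) (P : pred nat) :
  (forall i, i <= e -> r i \in D) -> f @* par e r P = par e (f \o r) P.
Proof.
move=> rD; rewrite morphim_gen; last first.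
  by apply/subsetP=> _ /imsetP[i _ ->]; apply: rD; rewrite -ltnS ltn_ord.
congr <<_>>; rewrite morphimEsub; last first.
  by apply/subsetP=> _ /imsetP[i _ ->]; apply: rD; rewrite -ltnS ltn_ord.
by rewrite -imset_comp.
Qed.

(** [eps] is the parity of the number of occurrences of the last generator; that it
    is well defined does not follow from the other axioms, and it is what the
    amalgamation is taken over. *)
Record string_cgroup (gT : finGroupType) (e : nat) (r : nat -> gT) (eps : gT -> bool) : Prop :=
  StringCGroup {
  sc_order2 : forall i, i <= e -> #[r i] = 2;
  sc_string : forall i j, i.+1 < j -> j <= e -> commute (r i) (r j);
  sc_inter : forall P Q : pred nat, par e r P :&: par e r Q \subset par e r (predI P Q);
  sc_eps : parity_hom (par e r predT) eps;
  sc_eps_last : eps (r e);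
  sc_eps_lt : forall i, i < e -> ~~ eps (r i) }.

(** Here [n] is the exponent of the order and the rank is [size ks] plus one. Carrying [eps] allows
    the amalgamation to be iterated. *)
Definition realizable (ks : seq nat) (n : nat) : Prop :=
  exists (gT : finGroupType) (r : nat -> gT) (eps : gT -> bool),
    [/\ string_cgroup (size ks) r eps,
        forall i, i < size ks -> #[r i * r i.+1] = (2 ^ nth 0 ks i)%N
      & #|par (size ks) r predT| = (2 ^ n)%N].

Lemma realizable_nil : realizable [::] 1.
Proof.
exists C2, (fun=> true : C2), (fun x : C2 => x).
have par0 : #|par 0 (fun=> true : C2) predT| = 2.
  rewrite /par /= (_ : [set _ | _ in _] = [set (true : C2)]); first exact: order_C2.
  apply/setP=> x; rewrite inE; apply/imsetP/eqP=> [[] // | ->].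
  by exists ord0; rewrite ?inE.
split=> //; split=> //; first by move=> i _; apply: order_C2.
move=> P Q; have [P0 | nP0] := boolP (P 0); have [Q0 | nQ0] := boolP (Q 0).
- apply: (subset_trans (subsetIl _ _)); apply: parS => i; rewrite leqn0 => /eqP-> _.
  exact/andP.
- apply: (subset_trans (subsetIr _ _)); apply: parS => i; rewrite leqn0 => /eqP->.
  by rewrite (negPf nQ0).
- apply: (subset_trans (subsetIl _ _)); apply: parS => i; rewrite leqn0 => /eqP->.
  by rewrite (negPf nP0).
apply: (subset_trans (subsetIl _ _)); apply: parS => i; rewrite leqn0 => /eqP->.
by rewrite (negPf nP0).
Qed.

(** * The fibre product with a dihedral group *)

Section Extension.

Variables (gT dT : finGroupType) (e k : nat) (r : nat -> gT) (eps : gT -> bool).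
Variables (a b : dT) (da db : dT -> bool).
Hypothesis scG : string_cgroup e r eps.
Hypothesis dpD : dihedral_pair k a b da db.

Local Notation G := (par e r predT).

(** The generators of the fibre product over [eps = da]: the last generator is glued to [a], and [b]
    becomes the new last one. *)
Definition extend (i : nat) : gT * dT :=
  if i < e then (r i, 1) else if i == e then (r e, a) else (1, b).

Local Notation s := extend.
Local Notation H := (par e.+1 s).

Lemma extend_lt i : i < e -> s i = (r i, 1).
Proof. by rewrite /s => ->. Qed.

Lemma extend_eq : s e = (r e, a).
Proof. by rewrite /s ltnn eqxx. Qed.

Lemma extend_last : s e.+1 = (1, b).
Proof. by rewrite /s ltnNge leqnSn /= eqn_leq ltnn. Qed.

Lemma extend_case i : i <= e.+1 -> [\/ i < e, i = e | i = e.+1].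
Proof.
rewrite leq_eqVlt => /orP[/eqP-> | ]; first by constructor 3.
by rewrite ltnS leq_eqVlt => /orP[/eqP-> | lt_ie]; [constructor 2 | constructor 1].
Qed.

Lemma extend_par_sub (K : {group gT * dT}) (P : pred nat) :
  (forall i, i < e -> P i -> (r i, 1) \in K) -> (P e -> (r e, a) \in K) ->
  (P e.+1 -> (1, b) \in K) -> H P \subset K.
Proof.
move=> K1 K2 K3; apply: par_subP => i /extend_case[lt_ie | -> | ->].
- by rewrite extend_lt //; apply: K1.
- by rewrite extend_eq.
by rewrite extend_last.
Qed.

Lemma extend_compat_group_set :
  group_set [set u : gT * dT | (u.1 \in G) && (eps u.1 == da u.2)].
Proof.
apply/group_setP; split=> [|[x1 x2] [y1 y2]]; rewrite !inE /=.
  by rewrite group1 (parity_hom1 (sc_eps scG))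
    (parity_hom1 (dp_da dpD : parity_hom [group of setT] da)).
move=> /andP[Gx /eqP ex] /andP[Gy /eqP ey].
by rewrite groupM // (sc_eps scG) // (dp_da dpD) ?inE // ex ey eqxx.
Qed.

(** The fibre product of [eps] and [da] is a group that contains every generator [s i]. *)
Lemma extend_compat P g x : (g, x) \in H P -> eps g = da x.
Proof.
move=> Hgx; have: (g, x) \in Group extend_compat_group_set.
  apply: subsetP Hgx; apply: extend_par_sub => [i lt_ie _ | _ | _].
  - rewrite inE /= mem_par ?(ltnW lt_ie) // (negPf (sc_eps_lt scG lt_ie)).
    by rewrite (parity_hom1 (dp_da dpD : parity_hom [group of setT] da)).
  - by rewrite inE /= mem_par // (sc_eps_last scG) (dp_daa dpD).
  by rewrite inE /= group1 (parity_hom1 (sc_eps scG)) (negPf (dp_dab dpD)).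
by rewrite inE => /andP[_ /eqP].
Qed.

Lemma extend_fst_in P g x : (g, x) \in H P -> g \in par e r P.
Proof.
move=> Hgx; have: (g, x) \in setX_group (par_group e r P) [group of setT].
  apply: subsetP Hgx; apply: extend_par_sub => [i lt_ie Pi | Pe | Pe1];
    by rewrite inE /= ?group1 ?mem_par ?inE // ltnW.
by rewrite inE => /andP[].
Qed.

(** A bound for the projection of [H P] to the dihedral factor; an absent generator is replaced by
    1. *)
Definition snd_par (P : pred nat) : {set dT} :=
  <[if P e then a else 1%g]> <*> <[if P e.+1 then b else 1%g]>.

Canonical snd_par_group P := Eval hnf in [group of snd_par P].

Lemma extend_snd_in P g x : (g, x) \in H P -> x \in snd_par P.
Proof.
move=> Hgx; have: (g, x) \in setX_group [group of setT] (snd_par_group P).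
  apply: subsetP Hgx; apply: extend_par_sub => [i lt_ie Pi | Pe | Pe1].
  - by rewrite inE /= group1 inE.
  - by rewrite inE /= inE mem_gen // Pe inE cycle_id.
  by rewrite inE /= inE mem_gen // Pe1 inE cycle_id orbT.
by rewrite inE => /andP[].
Qed.

Lemma snd_par_notl P x : ~~ P e -> x \in snd_par P -> x = 1 \/ P e.+1 /\ x = b.
Proof.
move=> /negPf Pe; rewrite /snd_par Pe cycle1 joing1G.
case: (P e.+1); last by rewrite /= ?cycle1 => /set1P->; left.
by case/(mem_cycle2 (dp_b2 dpD)) => ->; [left | right].
Qed.

Lemma snd_par_notr P x : ~~ P e.+1 -> x \in snd_par P -> x = 1 \/ P e /\ x = a.
Proof.
move=> /negPf Pe; rewrite /snd_par Pe cycle1 joingG1.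
case: (P e); last by rewrite /= ?cycle1 => /set1P->; left.
by case/(mem_cycle2 (dp_a2 dpD)) => ->; [left | right].
Qed.

Lemma snd_par_sub P : snd_par P \subset <<[set a; b]>>.
Proof.
rewrite join_subG !cycle_subG.
by case: (P e); case: (P e.+1); rewrite ?group1 ?mem_gen ?set21 ?set22.
Qed.

Lemma extend_surj P g : g \in par e r P -> exists x, (g, x) \in H P.
Proof.
move=> Gg; have: g \in [morphism of @fst gT dT] @* H P.
  apply: subsetP Gg; apply: par_subP => i le_ie Pi.
  have Hi : s i \in H P by apply: mem_par => //; apply: ltnW.
  have -> : r i = (s i).1.
    by move: le_ie; rewrite leq_eqVlt => /orP[/eqP-> | /extend_lt->//]; rewrite extend_eq.
  exact: mem_morphim.
by case/morphimP=> [[g1 x]] _ Hg /= ->; exists x.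
Qed.

Lemma extend_left (P : pred nat) g : ~~ P e -> g \in par e r P -> (g, 1) \in H P.
Proof.
move=> nPe Gg; have: g \in [morphism of @pairg1 gT dT] @*^-1 H P.
  apply: subsetP Gg; apply: par_subP => i; rewrite leq_eqVlt => /orP[/eqP-> | lt_ie Pi].
    by rewrite (negPf nPe).
  have Hi : s i \in H P by apply: mem_par => //; apply/ltnW/ltnW.
  by rewrite extend_lt // in Hi; rewrite mem_morphpre ?inE.
by case/morphpreP.
Qed.

(** [(1, b ^ a)] is the conjugate of [(1, b)] by the glued generator [(r e, a)]. *)
Lemma extend_right (P : pred nat) x : P e -> P e.+1 -> x \in <<[set a; b]>> ->
  ~~ da x -> (1, x) \in H P.
Proof.
move=> Pe Pe1 Dx dx; have Mx := dp_ker dpD Dx dx.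
have Hb : (1, b) \in H P by rewrite -extend_last mem_par.
have: x \in [morphism of @pair1g gT dT] @*^-1 H P.
  apply: subsetP Mx; rewrite gen_subG; apply/subsetP=> y /set2P[] ->.
    by rewrite mem_morphpre ?inE.
  have baE : ((1, b) : gT * dT) ^ s e = (1, b ^ a).
    by rewrite extend_eq; congr (_, _); rewrite /= mul1g mulVg.
  by rewrite mem_morphpre ?inE //; have := groupJ Hb (mem_par s (leqnSn e) Pe); rewrite baE.
by case/morphpreP.
Qed.

(** The first coordinate is controlled by the intersection property of [G]; the second depends on
    whether [e] and [e.+1] belong to [K]. *)
Lemma extend_inter P Q : H P :&: H Q \subset H (predI P Q).
Proof.
set K := predI P Q; apply/subsetP=> [[g x]] /setIP[Pgx Qgx].
have Gg : g \in par e r K.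
  apply: subsetP (sc_inter scG P Q) _ _.
  by rewrite inE (extend_fst_in Pgx) (extend_fst_in Qgx).
have [Px Qx] := (extend_snd_in Pgx, extend_snd_in Qgx).
have pairE : (g, x) = (g, 1) * (1, x) :> gT * dT by congr (_, _); rewrite /= ?mulg1 ?mul1g.
(* Without [e] in [K], [(g, 1)] lies in [H K] and [x] is 1 or [b]. As [b] is neither 1 nor [a], the
   case [x = b] forces [e.+1] into both [P] and [Q]. *)
have [Ke | nKe] := boolP (K e); last first.
  rewrite pairE groupM ?extend_left //.
  have one P' Q' : ~~ P' e -> x \in snd_par P' -> x \in snd_par Q' ->
      x = 1 \/ [/\ P' e.+1, Q' e.+1 & x = b].
    move=> nPe /(snd_par_notl nPe)[-> | [Pe1 ->]] Qb; first by left.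
    right; split=> //; apply: contraT => /snd_par_notr/(_ Qb)[b1 | [_ ba]].
      by have := dp_b_neq1 dpD; rewrite b1 eqxx.
    by have := dp_neq dpD; rewrite -ba eqxx.
  have [-> | [Pe1 Qe1 ->]] : x = 1 \/ [/\ P e.+1, Q e.+1 & x = b].
  - move: nKe; rewrite /K /= negb_and => /orP[nPe | nQe]; first exact: one.
    by case: (one _ _ nQe Qx Px) => [-> | []]; [left | right].
  - exact: (group1 (par_group e.+1 s K)).
  by rewrite -extend_last mem_par //= Pe1.
(* With [e] in [K], [g] has some lift [(g, y)] in [H K], and [y] has the parity of [x]. *)
have [y Hgy] := extend_surj Gg.
have day : da y = da x by rewrite -(extend_compat Pgx) (extend_compat Hgy).
have [Ke1 | nKe1] := boolP (K e.+1); last first.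
  suff <- : y = x by [].
  (* Without [e.+1] in [K], both [x] and [y] are 1 or [a], which [da] tells apart. *)
  have xa : x = 1 \/ x = a.
    move: nKe1; rewrite /K /= negb_and => /orP[nP | nQ].
      by case: (snd_par_notr nP Px) => [|[]]; [left | right].
    by case: (snd_par_notr nQ Qx) => [|[]]; [left | right].
  have ya : y = 1 \/ y = a.
    by case: (snd_par_notr nKe1 (extend_snd_in Hgy)) => [|[]]; [left | right].
  move: day; have da1 := parity_hom1 (dp_da dpD : parity_hom [group of setT] da).
  by case: xa ya => -> [] ->; rewrite ?da1 ?(dp_daa dpD).
(* With [e] and [e.+1] both in [K], the correction [y^-1 * x] is even, so [extend_right] applies. *)
have xE : (g, x) = (g, y) * (1, y^-1 * x) :> gT * dT.
  by congr (_, _); rewrite /= ?mulg1 ?mulKVg.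
have [Dx Dy] := (subsetP (snd_par_sub P) x Px, subsetP (snd_par_sub K) y (extend_snd_in Hgy)).
rewrite xE groupM // extend_right //; first by rewrite groupM ?groupV.
have := dp_da dpD (in_setT y) (in_setT (y^-1 * x)); rewrite mulKVg day.
by case: (da x); case: (da _).
Qed.

(** The projection to [G] is onto, and its kernel is the kernel of [da] on the dihedral group, of
    order [2 ^ k]. *)
Lemma extend_card : 1 < k -> #|H predT| = (#|G| * 2 ^ k)%N.
Proof.
move=> k_gt1; pose f := [morphism of @fst gT dT].
have fH : f @* H predT = G.
  apply/setP=> g; apply/morphimP/idP=> [[[g1 x] _ Hg ->] | /extend_surj[x Hg]].
    exact: extend_fst_in Hg.
  by exists (g, x).
have kerf : H predT :&: 'ker f = setX [1] <<[set b; b ^ a]>>.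
  apply/setP=> [[g x]]; rewrite in_setI in_setX; apply/andP/andP=> [[Hgx kgx] | [/set1P-> Mx]].
    have g1 : g = 1 by have /= := mker kgx.
    split; first by rewrite g1 set11.
    apply: (dp_ker dpD); first exact: subsetP (snd_par_sub predT) _ (extend_snd_in Hgx).
    by rewrite -(extend_compat Hgx) g1 (parity_hom1 (sc_eps scG)).
  split; last exact/(kerP f (in_setT (1, x))).
  apply: extend_right => //; last by rewrite (dp_ker_notin dpD).
  apply: subsetP Mx; rewrite gen_subG; apply/subsetP=> y /set2P[] ->.
    by rewrite mem_gen ?set22.
  by rewrite groupJ ?mem_gen ?set21 ?set22.
rewrite -(LagrangeI _ ('ker f)) kerf cardsX cards1 mul1n (dp_card_ker dpD) // mulnC.
by rewrite -fH card_morphim setTI.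
Qed.

Lemma extend_string_cgroup : string_cgroup e.+1 s (fun u => db u.2).
Proof.
split.
- move=> i /extend_case[lt_ie | -> | ->].
  + by rewrite extend_lt // order_pair order1 lcmn1 (sc_order2 scG) // ltnW.
  + by rewrite extend_eq order_pair (sc_order2 scG) // (dp_oa dpD).
  by rewrite extend_last order_pair order1 lcm1n (dp_ob dpD).
- move=> i j lt_ij le_je.
  have lt_ie : i < e by lia.
  rewrite /commute extend_lt //; move: lt_ij.
  case: (extend_case le_je) => [lt_je | -> | ->] lt_ij.
  + rewrite extend_lt //; congr (_, _) => //=.
    by apply: (sc_string scG) => //; apply: ltnW.
  + rewrite extend_eq; congr (_, _); rewrite /= ?mulg1 ?mul1g //.
    exact: (sc_string scG).
  by rewrite extend_last; congr (_, _); rewrite /= ?mulg1 ?mul1g.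
- exact: extend_inter.
- by move=> u v _ _ /=; rewrite (dp_db dpD) ?inE.
- by rewrite extend_last (dp_dbb dpD).
move=> i; rewrite ltnS leq_eqVlt => /orP[/eqP-> | lt_ie].
  by rewrite extend_eq (dp_dba dpD).
by rewrite extend_lt //= (parity_hom1 (dp_db dpD : parity_hom [group of setT] db)).
Qed.

Lemma extend_order_lt i : i.+1 < e -> #[s i * s i.+1] = #[r i * r i.+1].
Proof.
move=> lt_ie; rewrite !extend_lt // 1?ltnW //.
rewrite (_ : _ * _ = (r i * r i.+1, 1)); last by congr (_, _); rewrite /= mulg1.
by rewrite order_pair order1 lcmn1.
Qed.

(** Gluing [a] to [r e] replaces the order of the rotation by its least common multiple with 2, so
    an even order is unchanged. *)
Lemma extend_order_eq i : i.+1 = e -> 2 %| #[r i * r i.+1] -> #[s i * s i.+1] = #[r i * r i.+1].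
Proof.
move=> ie d2; rewrite ie extend_eq extend_lt -?ie // ie.
rewrite (_ : _ * _ = (r i * r e, a)); last by congr (_, _); rewrite /= mul1g.
by rewrite order_pair (dp_oa dpD) -ie; apply/lcmn_idPl.
Qed.

Lemma extend_order_last : 0 < k -> #[s e * s e.+1] = (2 ^ k)%N.
Proof.
move=> k_gt0; rewrite extend_eq extend_last.
rewrite (_ : _ * _ = (r e, a * b)); last by congr (_, _); rewrite /= mulg1.
rewrite order_pair (dp_order dpD) (sc_order2 scG) //; apply/lcmn_idPr.
by rewrite -(prednK k_gt0) expnS dvdn_mulr.
Qed.

End Extension.

Lemma realizable_rcons ks n k :
  {in ks, forall m, 1 < m} -> 1 < k -> realizable ks n -> realizable (rcons ks k) (n + k).
Proof.
move=> ks_gt1 k_gt1 [gT [r [eps [scG ord cardG]]]].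
have [dT [a [b [da [db dpD]]]]] := exists_dihedral_pair (ltnW k_gt1).
exists (gT * dT)%type, (extend (size ks) r a b), (fun u => db u.2).
rewrite size_rcons; split; first exact: (extend_string_cgroup scG dpD).
  move=> i; rewrite ltnS leq_eqVlt nth_rcons => /orP[/eqP-> | lt_i].
    by rewrite ltnn eqxx (extend_order_last scG dpD) // ltnW.
  have ki := ord i lt_i; rewrite lt_i -ki.
  move: (lt_i); rewrite leq_eqVlt => /orP[/eqP ie | lt_ie].
    rewrite (extend_order_eq dpD) // ki.
    by have := ks_gt1 _ (mem_nth 0 lt_i); case: (nth _ _ _) => // m _; rewrite expnS dvdn_mulr.
  exact: extend_order_lt.
by rewrite (extend_card scG dpD) // cardG expnD.
Qed.

End StringGroups.
(** * Rank 3 groups of prescribed order *)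

Section Growth.

Local Open Scope group_scope.

(** The intersection property for two distinct singletons makes their parabolic subgroups meet
    trivially. *)
Lemma sc_inj (gT : finGroupType) e (r : nat -> gT) eps i j :
  string_cgroup e r eps -> i <= e -> j <= e -> i != j -> r i != r j.
Proof.
move=> scG le_i le_j neq_ij; apply/eqP=> eqr.
have : r i \in par e r (pred1 i) :&: par e r (pred1 j).
  by rewrite inE {2}eqr !mem_par //= eqxx.
move=> /(subsetP (sc_inter scG _ _)); have -> : par e r (predI (pred1 i) (pred1 j)) = 1.
  apply/trivgP/(@par_subP _ e r _ 1%G) => m _ /andP[/= /eqP->].
  by rewrite (negPf neq_ij).
move=> /set1P r1; have := sc_order2 scG le_i.
by rewrite r1 order1.
Qed.

Lemma par_pair (gT : finGroupType) e (r : nat -> gT) i j :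
  i <= e -> j <= e -> par e r (pred2 i j) = <<[set r i; r j]>>.
Proof.
move=> le_i le_j; apply/eqP; rewrite eqEsubset; apply/andP; split.
  by apply: par_subP => m _ /orP[] /eqP->; rewrite mem_gen ?set21 ?set22.
by rewrite join_subG !sub1set !mem_par //= eqxx ?orbT.
Qed.

Lemma sc_order02 (gT : finGroupType) (r : nat -> gT) eps :
  string_cgroup 2 r eps -> #[r 0 * r 2] = 2.
Proof.
move=> scG; apply/eqP/order2P; split.
  have := sc_inj scG (isT : 0 <= 2) (isT : 2 <= 2) isT.
  by rewrite -eq_invg_mul invg_expg (sc_order2 scG) // expg1.
have rr i : i <= 2 -> r i * r i = 1.
  by move=> le_i; have /eqP/order2P[] := sc_order2 scG le_i.
have c02 : r 0 * r 2 = r 2 * r 0 by apply: (sc_string scG).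
by rewrite {2}c02 mulgA -(mulgA (r 0)) rr // mulg1 rr.
Qed.

(** * Lifting a rank 3 string C-group along a morphism *)

Section Lift.

Variables (gT lT : finGroupType) (D : {group gT}) (f : {morphism D >-> lT}).
Variables (r : nat -> gT) (l : nat -> lT) (eps : lT -> bool).
Hypothesis scL : string_cgroup 2 l eps.
Hypothesis rD : forall i, i <= 2 -> r i \in D.
Hypothesis fr : forall i, i <= 2 -> f (r i) = l i.
Hypothesis rr : forall i, i <= 2 -> r i * r i = 1.
Hypothesis rX : forall i j, i < j -> j <= 2 -> (r i * r j) ^+ #[l i * l j] = 1.

Lemma lift_order2 i : i <= 2 -> #[r i] = 2.
Proof.
move=> le_i; apply/eqP/order2P; split; last exact: rr.
apply/eqP=> r1; have := sc_order2 scL le_i.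
by rewrite -fr // r1 morph1 order1.
Qed.

Lemma lift_order i j : i < j -> j <= 2 -> #[r i * r j] = #[l i * l j].
Proof.
move=> lt_ij le_j; have le_i : i <= 2 by rewrite (leq_trans (ltnW lt_ij)).
apply/eqP; rewrite eqn_dvd order_dvdn rX // eqxx /= -!fr // -morphM ?rD //.
by rewrite morph_order // groupM ?rD.
Qed.

Lemma lift_par P : f @* par 2 r P = par 2 l P.
Proof. by rewrite morphim_par //; apply: eq_par => i le_i; apply: fr. Qed.

(** A proper parabolic lies in a subgroup generated by two involutions. Its order is twice that of
    their product, which [f] preserves, so [f] is injective there. *)
Lemma lift_inj (P : pred nat) x : ~~ [&& P 0, P 1%N & P 2] ->
  x \in par 2 r P -> f x = 1 -> x = 1.
Proof.
move=> nP Px fx1.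
have [i [j [lt_ij le_j Rx]]] : exists i j, [/\ i < j, j <= 2 & x \in <<[set r i; r j]>>].
  have pairP i j : i < j -> j <= 2 -> (forall m, m <= 2 -> P m -> pred2 i j m) ->
      exists i j, [/\ i < j, j <= 2 & x \in <<[set r i; r j]>>].
    move=> lt_ij le_j sP; exists i, j; split=> //.
    rewrite -(@par_pair _ 2) // 1?(leq_trans (ltnW lt_ij)) //.
    exact: subsetP (parS r sP) x Px.
  move: nP; rewrite !negb_and => /or3P[] nP;
    [apply: (pairP 1%N 2) | apply: (pairP 0 2) | apply: (pairP 0 1%N)] => //;
    by move=> [|[|[|m]]] //= _; rewrite ?(negPf nP).
have le_i : i <= 2 by rewrite (leq_trans (ltnW lt_ij)).
have neq_l : l i != l j by apply: sc_inj scL _ _ _ => //; rewrite neq_ltn lt_ij.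
have neq_r : r i != r j by apply: contra neq_l => /eqP eqr; rewrite -!fr // eqr.
pose R := <<[set r i; r j]>>%G.
have RD : R \subset D by rewrite join_subG !sub1set !rD.
have fR : f @* R = <<[set l i; l j]>>.
  by rewrite /= -(@par_pair _ 2) // lift_par par_pair.
have cR : #|f @* R| = #|R|.
  rewrite fR /= !card_gen_involutions ?lift_order2 //; try exact: sc_order2 scL _ _.
  by rewrite lift_order.
have kerR : R :&: 'ker f = 1.
  apply: card1_trivg; have := LagrangeI R ('ker f).
  have := card_morphim f R; rewrite (setIidPr RD) => <-; rewrite cR.
  by rewrite -[X in _ = X]mul1n => /eqP; rewrite eqn_pmul2r ?cardG_gt0 // => /eqP.
have : x \in R :&: 'ker f by rewrite inE Rx; apply/kerP => //; apply: (subsetP RD).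
by rewrite kerR => /set1P.
Qed.

(** For the intersection property with [P] proper, the image of [x] lies in the parabolic of
    [predI P Q] below. A preimage [y] there differs from [x] by a kernel element of [par 2 r P], so
    [y = x]. *)
Lemma lift_string_cgroup : string_cgroup 2 r (eps \o f).
Proof.
have subD P : par 2 r P \subset D by apply: par_subP => i le_i _; apply: rD.
split.
- exact: lift_order2.
- move=> i j lt_ij le_j; have [i0 j2] : i = 0 /\ j = 2 by lia.
  rewrite i0 j2 in lt_ij le_j *.
  have := @rX 0 2 isT isT; rewrite (sc_order02 scL) expgS expg1 => r02.
  have /eqP := r02; rewrite -eq_invg_mul invMg => /eqP.
  have rV i' : i' <= 2 -> (r i')^-1 = r i' by move=> ?; apply/eqP; rewrite eq_invg_mul rr.
  by rewrite !rV.
- move=> P Q; apply/subsetP=> x /setIP[Px Qx].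
  have [Pall | nP] := boolP [&& P 0, P 1%N & P 2].
    apply: subsetP Qx; apply: parS => i le_i Qi; rewrite /= Qi andbT.
    by move: i le_i Qi Pall => [|[|[|]]] // _ _ /and3P[].
  have fx : f x \in par 2 l (predI P Q).
    apply: (subsetP (sc_inter scL P Q)).
    by rewrite inE -!lift_par !mem_morphim ?(subsetP (subD P)).
  rewrite -lift_par in fx; case/morphimP: fx => y Dy Ky fxy.
  have Py : y \in par 2 r P by apply: subsetP Ky; apply: parS => i _ /andP[].
  have Dx := subsetP (subD P) x Px.
  have : y^-1 * x = 1.
    apply: (lift_inj nP); first by rewrite groupM ?groupV.
    by rewrite morphM ?groupV // morphV // fxy mulVg.
  by move/eqP; rewrite -eq_mulVg1 => /eqP <-.
- move=> x y Gx Gy; have [Dx Dy] := (subsetP (subD _) x Gx, subsetP (subD _) y Gy).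
  rewrite /= morphM // (sc_eps scL) // -lift_par mem_morphim //.
- by rewrite /= fr // (sc_eps_last scL).
by move=> i lt_i; rewrite /= fr ?(sc_eps_lt scL) // ltnW.
Qed.

End Lift.

(** * Growing the order in rank 3 *)

Lemma quotient_of_order (gT lT : finGroupType) (H : {group gT}) (f : {morphism H >-> lT}) m :
  2.-group H -> 2 ^ m <= #|H| -> #|f @* H| <= 2 ^ m ->
  exists Q : {group gT}, [/\ Q <| H, Q \subset 'ker f & #|H / Q| = (2 ^ m)%N].
Proof.
move=> pH; have cH := card_pgroup pH; have kH : 'ker f \subset H by apply: subsetIl.
have ck := card_pgroup (pgroupS kH pH).
rewrite card_morphim setIid -divgS // cH ck => le_mH.
have le_kH : logn 2 #|'ker f| <= logn 2 #|H| by apply: lognSg.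
rewrite -expnB // => le_fm; rewrite leq_exp2l // in le_mH; rewrite leq_exp2l // in le_fm.
(* A normal subgroup of a 2-group contains subgroups, normal in the whole group, of every order
   dividing its own; index [2 ^ m] is wanted. *)
have le_r : logn 2 #|H| - m <= logn 2 #|'ker f| by rewrite leq_subCl.
have [Q [sQk nQ cQ]] := normal_pgroup pH (ker_normal f) le_r.
exists Q; split=> //; rewrite card_quotient ?normal_norm // -divgS ?normal_sub // cQ {1}cH.
by rewrite -expnB ?leq_subr // subKn.
Qed.

Lemma realizable3_grow k1 k2 n m :
  1 < k1 -> 1 < k2 -> realizable [:: k1; k2] n -> n <= m -> realizable [:: k1; k2] m.
Proof.
move=> k1_gt1 k2_gt1 [lT [l [eps [scL ordL cardL]]]] le_nm; rewrite /= in scL ordL cardL *.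
(* The exponent [m.+1] is positive and makes the translation long enough to give [H] order at least
   [2 ^ m]. *)
have [dT [a [b [da [db dpD]]]]] := exists_dihedral_pair (ltn0Sn m).
have [aa bb] := (dp_a2 dpD, dp_b2 dpD).
(* [t 0], [t 1], [t 2] generate the {4,4} toroidal group; [t 0 * t 2 ^ t 1] is a translation. *)
pose t i : wreath2 dT := nth 1 [:: base2 a 1; swap2 dT; base2 1 b] i.
pose s i : wreath2 dT * lT := (t i, l i).
have tt i : i <= 2 -> t i * t i = 1.
  by case: i => [|[|[|]]] // _; rewrite /t /= ?swap2K // base2M ?aa ?bb mulg1.
have ll i : i <= 2 -> l i * l i = 1.
  by move=> le_i; have /eqP/order2P[] := sc_order2 scL le_i.
have t01 : (t 0 * t 1%N) ^+ 4 = 1.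
  have sq : (t 0 * t 1%N) ^+ 2 = base2 a a.
    by rewrite expgS expg1 -mulgA (mulgA (t 1%N)) swap2_base2 base2M mul1g mulg1.
  by rewrite (expgM _ 2 2) sq expgS expg1 base2M aa.
have t12 : (t 1%N * t 2) ^+ 4 = 1.
  have sq : (t 1%N * t 2) ^+ 2 = base2 b b.
    by rewrite expgS expg1 mulgA swap2_base2 base2M mul1g mulg1.
  by rewrite (expgM _ 2 2) sq expgS expg1 base2M bb.
have t02 : (t 0 * t 2) ^+ 2 = 1.
  by rewrite base2M mul1g mulg1 expgS expg1 base2M aa bb.
(* The orders in the toroidal group divide 4, 2 and 4, hence those in [L], as [k1] and [k2] are at
   least 2. So pairing with [t] does not increase them. *)
have sX i j : i < j -> j <= 2 -> (s i * s j) ^+ #[l i * l j] = 1.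
  move=> lt_ij le_j; rewrite (_ : s i * s j = (t i * t j, l i * l j)) // expg_pair expg_order.
  rewrite (_ : (t i * t j) ^+ _ = 1) //; apply/eqP; rewrite -order_dvdn.
  have dvd4 k : 1 < k -> 4 %| 2 ^ k by move=> k_gt1; apply: (@dvdn_exp2l 2 2).
  have [[-> ->]|[[-> ->]|[-> ->]]] :
      (i = 0 /\ j = 1%N) \/ (i = 0 /\ j = 2) \/ (i = 1%N /\ j = 2) by lia.
  - by rewrite ordL //= (dvdn_trans _ (dvd4 _ k1_gt1)) // order_dvdn t01.
  - by rewrite (sc_order02 scL) order_dvdn t02.
  by rewrite ordL //= (dvdn_trans _ (dvd4 _ k2_gt1)) // order_dvdn t12.
pose H := par_group 2 s predT; have sH i : i <= 2 -> s i \in H by move=> le_i; apply: mem_par.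
have pH : 2.-group H.
  have : 2.-group (setX_group [set: wreath2 dT]%G (par_group 2 l predT)).
    rewrite /pgroup cardsX pnatM cardsT card_wreath2 ?(dp_2group dpD) //=.
    by rewrite cardL pnatX.
  apply: pgroupS; apply: par_subP => i le_i _.
  by rewrite inE /= inE mem_par.
(* The element [u] lies over the translation [base2 (a * b) 1], of order [2 ^ m.+1]. *)
have leH : 2 ^ m <= #|H|.
  pose u := s 0 * (s 1%N * s 2 * s 1%N).
  have uE : u = (base2 (a * b) 1, u.2).
    congr (_, _); rewrite -[LHS]/(base2 a 1 * (swap2 dT * base2 1 b * swap2 dT)).
    by rewrite swap2_base2 base2M mulg1.
  have Hu : u \in H by rewrite !groupM ?sH.
  apply: leq_trans (dvdn_leq (cardG_gt0 H) (order_dvdG Hu)).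
  apply: leq_trans (_ : 2 ^ m.+1 <= _); first by rewrite leq_exp2l.
  apply: dvdn_leq (order_gt0 u) _; rewrite -(dp_order dpD) order_dvdn.
  by have := expg_order u; rewrite {1}uE expg_pair base2X => -[-> _].
pose f := restrm_morphism (subsetT H) [morphism of @snd (wreath2 dT) lT].
have fH : f @* H = par 2 l predT.
  by rewrite morphim_par //; apply: eq_par.
have [|Q [nQH sQk cQ]] := quotient_of_order (f := f) pH leH; first by rewrite fH cardL leq_exp2l.
have nQ := normal_norm nQH.
(* As [Q] lies in the kernel of [f], the projection to [L] factors through the quotient; [g] is the
   morphism to which the lifting lemmas apply. *)
have kQ : 'ker (coset_morphism Q) \subset 'ker f by rewrite ker_coset.
pose g := factm_morphism kQ nQ.
have gs i : i <= 2 -> g (coset Q (s i)) = l i by move=> le_i; exact: (factmE kQ nQ (sH i le_i)).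
have nS i : i <= 2 -> s i \in 'N(Q) by move=> le_i; rewrite (subsetP nQ) ?sH.
have Ds i : i <= 2 -> coset Q (s i) \in [group of coset_morphism Q @* H].
  by move=> le_i; rewrite mem_morphim ?nS ?sH.
have ss i : i <= 2 -> coset Q (s i) * coset Q (s i) = 1.
  move=> le_i; rewrite -morphM ?nS // (_ : s i * s i = 1) ?morph1 //.
  by rewrite -[RHS]/(1, 1) -(tt i le_i) -(ll i le_i).
have qX i j : i < j -> j <= 2 -> (coset Q (s i) * coset Q (s j)) ^+ #[l i * l j] = 1.
  move=> lt_ij le_j; have le_i : i <= 2 by rewrite (leq_trans (ltnW lt_ij)).
  by rewrite -morphM ?nS // -morphX ?groupM ?nS // sX // morph1.
exists (coset_of Q), (fun i => coset Q (s i)), (eps \o g); split.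
- exact: lift_string_cgroup scL Ds gs ss qX.
- by move=> i lt_i; rewrite (lift_order Ds gs qX) // ordL.
rewrite -cQ; congr #|pred_of_set _|; rewrite /quotient morphim_par //.
Qed.

End Growth.
(** * All ranks *)

Section Conclusion.

Local Open Scope group_scope.

Lemma realizable_cat ks ks' n :
  {in ks ++ ks', forall k, 1 < k} -> realizable ks n -> realizable (ks ++ ks') (n + sumn ks').
Proof.
elim: ks' ks n => [|k ks' IHks] ks n; first by rewrite cats0 addn0.
rewrite -cat_rcons /= addnA => gt1 realk; apply: IHks => //.
apply: realizable_rcons realk => [m km|]; apply: gt1.
  by rewrite mem_cat mem_rcons inE km orbT.
by rewrite mem_cat mem_rcons inE eqxx.
Qed.

Lemma realizable_all ks n :
  1 < size ks -> {in ks, forall k, 1 < k} -> sumn ks < n -> realizable ks n.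
Proof.
case: ks => [|k1 [|k2 ks]] //= _ gt1 lt_n.
have [k1_gt1 k2_gt1] : 1 < k1 /\ 1 < k2 by split; apply: gt1; rewrite !inE eqxx ?orbT.
(* All surplus order is placed in rank 3; the remaining amalgamations then contribute exactly
   [sumn ks]. *)
have -> : n = (n - sumn ks + sumn ks)%N by rewrite subnK; lia.
apply: (@realizable_cat [:: k1; k2]) => //.
apply: realizable3_grow (_ : realizable _ (1 + k1 + k2)) _ => //; last by lia.
apply: (@realizable_rcons [:: k1]) => //; first by move=> k /[!inE] /eqP->.
exact: (@realizable_rcons [::]) realizable_nil.
Qed.

(** * From generators indexed by naturals to tuples *)

Lemma string_cgroup_tuple (gT : finGroupType) e (r : nat -> gT) eps :
  string_cgroup e r eps ->
  exists rho : e.+1.-tuple gT,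
    string_C_group (par_group e r predT) rho /\ (forall i, i <= e -> nth 1 rho i = r i).
Proof.
move=> scG; pose rho := [tuple r i | i < e.+1]; exists rho.
have rhoE (i : 'I_e.+1) : tnth rho i = r i by rewrite tnth_mktuple.
split; last by move=> i le_i; rewrite -[i]/(val (Ordinal (le_i : i < e.+1))) -tnth_nth rhoE.
pose P (I : {set 'I_e.+1}) : pred nat := [pred n | n \in [seq val i | i in I]].
have PE I (i : 'I_e.+1) : P I (val i) = (i \in I).
  by rewrite /P /= (mem_map val_inj) mem_enum.
have parE I : parabolic rho I = par e r (P I) :> {set gT}.
  rewrite /par -(eq_imset _ rhoE); congr <<[set _ | _ in pred_of_set _]>>.
  by apply/setP=> i; rewrite !inE PE.
split.
- congr <<_>>; apply/setP=> x.
  by apply/imsetP/imsetP=> -[i _ ->]; exists i; rewrite ?inE ?rhoE.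
- by move=> i; rewrite rhoE (sc_order2 scG) // -ltnS.
- have comm (i j : 'I_e.+1) : i.+1 < j -> commute (r i) (r j).
    by move=> lt_ij; apply: (sc_string scG) => //; rewrite -ltnS.
  move=> i j dist; rewrite !rhoE.
  have [lt_ij | lt_ji] : i.+1 < j \/ j.+1 < i by lia.
    exact: comm.
  exact/commute_sym/comm.
move=> I J; apply/eqP; rewrite eqEsubset; apply/andP; split; last first.
  by rewrite subsetI !genS // imsetS // ?subsetIl ?subsetIr.
rewrite !parE; apply: subset_trans (sc_inter scG _ _) _; apply: parS => i le_i.
by rewrite -[i]/(val (Ordinal (le_i : i < e.+1))) => /andP[]; rewrite !PE inE => -> ->.
Qed.

End Conclusion.

Theorem theorem1p1 (d n : nat) (k : d.-1.-tuple nat)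
    (hd : 3 <= d) (hn : 10 <= n)
    (hk : forall i : 'I_d.-1, 2 <= tnth k i)
    (hsum : \sum_(i < d.-1) tnth k i <= n - 1) :
  exists (gT : finGroupType) (G : {group gT}) (rho : d.-tuple gT),
    [/\ string_C_group G rho,
        #|G| = 2 ^ n
      & string_type rho = [seq 2 ^ ki | ki <- k]].
Proof.
case: d k hd hk hsum => // e k hd hk hsum.
have [||| gT [r [eps []]]] := @realizable_all k n.
- by rewrite size_tuple.
- by move=> m /tnthP[i ->]; apply: hk.
(* The subtraction in [n - 1] is truncated; positivity of [n] turns the bound into a strict one by
   [n]. *)
- by rewrite sumnE big_tuple; lia.
rewrite size_tuple => scG ord cardG.
have [rho [scrho rhoE]] := string_cgroup_tuple scG.
exists gT, (par_group e r predT), rho; split=> //.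
apply: (@eq_from_nth _ 0) => [|i]; first by rewrite !size_map size_iota size_tuple.
rewrite size_map size_iota => lt_ie.
rewrite /string_type (nth_map 0) ?size_iota // nth_iota // (nth_map 0) ?size_tuple // -ord //.
by rewrite !rhoE // ltnW.
Qed.
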